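(* Let $r:\mathbb{Z}\to(0,\infty)$ be a non-decreasing, non-constant function satisfying $r(z)\,r(1-z)=1$ for all $z\in\mathbb{Z}$, and let $\underline\theta=(\theta_i)_{i\in\mathbb{Z}}$ be a sequence of real numbers with $\theta_i\in(-\bar\theta,\bar\theta)$ for all $i$. Then the product measure $\mu^{(\underline\theta)}$ on $\mathbb{Z}^{\mathbb{Z}}$ is stationary for the generator $L^{\mathrm{(d.t.)}}$ (the bricklayers' model with rate function $r$ as seen from the defect tracer) if and only if there exist $\beta>0$ and $\theta_{\mathrm{left}}\in\mathbb{R}$ such that $$r(z)=e^{-\beta/2}e^{\beta z}\quad\text{for all } z\in\mathbb{Z},$$ and $$\theta_i=\begin{cases}\theta_{\mathrm{left}}, & i\le -1,\\ \theta_{\mathrm{left}}-\beta, & i\ge 0.\end{cases}$$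
   Context: Let $r$ be as in the claim. For $n\in\{0,1,2,\dots\}$ put $r(n)!:=\prod_{y=1}^n r(y)$ (empty product $=1$), and $\bar\theta:=\lim_{n\to\infty}\log r(n)\in(0,\infty]$. For $\theta\in(-\bar\theta,\bar\theta)$ define $Z(\theta):=\sum_{z=-\infty}^{\infty}\frac{e^{\theta z}}{r(|z|)!}<\infty$ and the probability measure on $\mathbb{Z}$ $$\mu^{(\theta)}(z):=\frac{1}{Z(\theta)}\cdot\frac{e^{\theta z}}{r(|z|)!},\qquad z\in\mathbb{Z}.$$ For a sequence $\underline\theta=(\theta_i)_{i\in\mathbb{Z}}$ in $(-\bar\theta,\bar\theta)$, $\mu^{(\underline\theta)}$ is the product probability measure on $\Omega=\mathbb{Z}^{\mathbb{Z}}$ under which the coordinates $\omega_i$ are independent and $\omega_i$ has law $\mu^{(\theta_i)}$. For $k\in\mathbb{Z}$ and $\underline\omega\in\Omega$ let $(\tau_k\underline\omega)_i:=\omega_{i-k}$. For $i\in\mathbb{Z}$ let $\underline\omega^{(i,i+1)}$ be the configuration obtained from $\underline\omega$ by replacing $\omega_i$ by $\omega_i-1$ and $\omega_{i+1}$ by $\omega_{i+1}+1$. For a bounded cylinder function $\varphi:\Omega\to\mathbb{R}$ (bounded and depending on finitely many coordinates) the generator is $$\begin{aligned}(L^{\mathrm{(d.t.)}}\varphi)(\underline\omega)=&\sum_{i\ne -1,0}[r(\omega_i)+r(-\omega_{i+1})]\,[\varphi(\underline\omega^{(i,i+1)})-\varphi(\underline\omega)]\\&+[r(\omega_{-1})+r(-\omega_0-1)]\,[\varphi(\underline\omega^{(-1,0)})-\varphi(\underline\omega)]\\&+[r(\omega_0)+r(-\omega_1)]\,[\varphi(\underline\omega^{(0,1)})-\varphi(\underline\omega)]\\&+[r(-\omega_0)-r(-\omega_0-1)]\,[\varphi(\tau_1(\underline\omega^{(-1,0)}))-\varphi(\underline\omega)]\\&+[r(\omega_0+1)-r(\omega_0)]\,[\varphi(\tau_{-1}\underline\omega)-\varphi(\underline\omega)].\end{aligned}$$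 (Only finitely many terms of the sum are non-zero for a given cylinder function $\varphi$.) A probability measure $\mu$ on $\Omega$ is called stationary for $L^{\mathrm{(d.t.)}}$ if $\int (L^{\mathrm{(d.t.)}}\varphi)\,d\mu=0$ for every bounded cylinder function $\varphi$. *)

(* Defs.v *)
From HB Require Import structures.
From mathcomp Require Import all_boot all_order all_algebra finmap.
From mathcomp Require Import all_classical all_reals all_analysis.

Set Implicit Arguments.
Unset Strict Implicit.
Unset Printing Implicit Defensive.

Import Order.TTheory GRing.Theory Num.Theory.
Import numFieldNormedType.Exports.

Local Open Scope classical_set_scope.
Local Open Scope ring_scope.

(** Configurations, with the product sigma-algebra of the discrete one on
    [int]: it is generated by the events that constrain a single coordinate. *)

HB.instance Definition _ := isPointed.Build int 0.

Definition config := int -> int.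

HB.instance Definition _ := Pointed.on config.

Definition coord_event (i : int) (B : set int) : set config :=
  [set w | B (w i)].

Definition coord_events : set (set config) :=
  [set A | exists (i : int) (B : set int), A = coord_event i B].

Definition Omega := g_sigma_algebraType coord_events.

Definition shift_config (k : int) (w : config) : config := fun i => w (i - k).

(** The configuration written omega^(i,i+1). *)
Definition lay_brick (i : int) (w : config) : config :=
  fun j => if j == i then w j - 1 else if j == i + 1 then w j + 1 else w j.

Section Bricklayers.
Context {R : realType}.
Implicit Types (r : int -> R) (t : R) (theta : int -> R) (phi : config -> R).

Definition rate_function r : Prop :=
  [/\ forall z, 0 < r z,
      {homo r : x y / x <= y},
      ~ (exists c, forall z, r z = c) &
      forall z, r z * r (1 - z) = 1].

Definition rfact r (n : nat) : R := \prod_(1 <= y < n.+1) r y%:Z.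

Definition theta_bar r : \bar R := limn (fun n : nat => (ln (r n%:Z))%:E).

Definition site_weight r t (z : int) : R :=
  expR (t * z%:~R) / rfact r `|z|%N.

(** For a rate function [r] this is finite when [- theta_bar r < t < theta_bar r],
    so that [fine] below loses nothing. *)
Definition partition_function r t : \bar R :=
  (\esum_(z in [set: int]) (site_weight r t z)%:E)%E.

Definition site_pmf r t (z : int) : R :=
  (fine (partition_function r t))^-1 * site_weight r t z.

Definition independent_coordinates (mu : probability Omega R) : Prop :=
  forall (F : {fset int}) (B : int -> set int),
    (mu (\bigcap_(i in [set` F]) coord_event i (B i)) =
     \prod_(i <- F) mu (coord_event i (B i)))%E.

(** By uniqueness of measures on pi-systems at most one [mu] satisfies this. *)
Definition is_product_measure r theta (mu : probability Omega R) : Prop :=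
  independent_coordinates mu /\
  forall (i z : int), mu (coord_event i [set z]) = (site_pmf r (theta i) z)%:E.

Definition bounded_cylinder phi : Prop :=
  (exists F : {fset int}, forall w w' : config,
     (forall i, i \in F -> w i = w' i) -> phi w = phi w') /\
  (exists M : R, forall w, `|phi w| <= M).

(** The first sum is a finitely supported sum; see [generator_finite_support]
    for the fact that its support is finite when [phi] is a cylinder function. *)
Definition generator r phi (w : config) : R :=
  (\sum_(i \in [set i : int | i != -1 /\ i != 0])
     (r (w i) + r (- w (i + 1))) * (phi (lay_brick i w) - phi w))
  + (r (w (-1)) + r (- w 0 - 1)) * (phi (lay_brick (-1) w) - phi w)
  + (r (w 0) + r (- w 1)) * (phi (lay_brick 0 w) - phi w)
  + (r (- w 0) - r (- w 0 - 1)) * (phi (shift_config 1 (lay_brick (-1) w)) - phi w)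
  + (r (w 0 + 1) - r (w 0)) * (phi (shift_config (-1) w) - phi w).

Lemma generator_finite_support r phi (w : config) : bounded_cylinder phi ->
  finite_set [set i : int |
    (r (w i) + r (- w (i + 1))) * (phi (lay_brick i w) - phi w) != 0].
Proof.
move=> [[F phiF] _].
have fin : finite_set ([set` F] `|` [set i - 1 | i in [set` F]]).
  by rewrite finite_setU; split; [|apply: finite_image]; exact: finite_fset.
apply: sub_finite_set fin => i /=; apply: contra_neqP => /not_orP[iF i1F].
suff -> : phi (lay_brick i w) = phi w by rewrite subrr mulr0.
apply: phiF => j jF; rewrite /lay_brick; case: eqVneq => [ji|_].
  by case: iF; rewrite /= -ji.
case: eqVneq => [ji|//].
by case: i1F; exists j => //; rewrite ji addrK.
Qed.

(** Integrability is part of the meaning of the equation: for a fast growing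
    [r] the function [generator r phi] need not be integrable. *)
Definition stationary r (mu : probability Omega R) : Prop :=
  forall phi, bounded_cylinder phi ->
    mu.-integrable [set: Omega] (fun w => (generator r phi w)%:E) /\
    (\int[mu]_w (generator r phi w)%:E = 0)%E.

End Bricklayers.

(* Main.v *)
(* Testing the generator on the indicator of {w = b on [-n, n]} gives
   P(b) * window_flow n b, because r(z) p(z) = e^theta p(z - 1) turns every
   inflow into an explicit multiple of P(b) and every rate outside the window
   has mean e^theta or e^-theta. So stationarity forces window_flow = 0. The
   converse passes from indicators to bounded cylinder functions by dominated
   convergence, since r(z + 1) <= K r(z) makes all rates integrable; for
   exponential r and the stated theta a computation gives window_flow = 0.

   Now let window_flow = 0. The two jumps of the tracer shift the
   parameters, which produces the densities exp((theta_(j-1) - theta_j) b_j)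
   and exp((theta_(j+1) - theta_j) b_j). Away from the tracer, varying b_k and
   b_(k+1) separates these from the single site terms, and signs force theta
   to be constant on both sides. Varying b_1 then gives theta_0 = theta_1 and
   that r(z) r(-z) is constant, i.e. r is exponential; varying b_(-1) gives the
   size of the jump of theta. *)

Require Import Defs.
From mathcomp Require Import all_boot all_order all_algebra finmap.
From mathcomp Require Import all_classical all_reals all_analysis.
From mathcomp Require Import measurable_realfun zify ring lra.

Import Order.TTheory GRing.Theory Num.Theory.
Import numFieldNormedType.Exports.

Local Open Scope classical_set_scope.
Local Open Scope ring_scope.

(** * Means and cylinder events *)

Definition cyl_event (s : seq int) (b : config) : set config :=
  [set w | forall i, i \in s -> w i = b i].

Lemma cyl_event_nil b : cyl_event [::] b = [set: config].
Proof. by apply/seteqP; split. Qed.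

Lemma cyl_event_cons j s b :
  cyl_event (j :: s) b = coord_event j [set b j] `&` cyl_event s b.
Proof.
apply/seteqP; split => w /=.
  move=> h; split; first by apply: h; rewrite mem_head.
  by move=> i si; apply: h; rewrite inE si orbT.
by move=> [wj h] i; rewrite inE => /predU1P[->|/h].
Qed.

Lemma measurable_coord_event i (B : set int) :
  measurable (coord_event i B : set Omega).
Proof. by apply: sub_gen_smallest; exists i, B. Qed.

Lemma measurable_cyl_event s b : measurable (cyl_event s b : set Omega).
Proof.
elim: s => [|j s IHs]; first by rewrite cyl_event_nil; exact: measurableT.
rewrite cyl_event_cons; apply: measurableI => //; exact: measurable_coord_event.
Qed.

Section Mean.
Context {R : realType} (mu : probability Omega R).
Implicit Types (f g : config -> R).

(** Integrability travels with the value, because stationarity asserts both and linearity of the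
    integral requires it. *)
Definition has_mean f (v : R) :=
  mu.-integrable [set: Omega] (EFin \o f) /\
  (\int[mu]_(w in [set: Omega]) (f w)%:E = v%:E)%E.

Lemma has_meanD f g u v :
  has_mean f u -> has_mean g v -> has_mean (fun w => f w + g w) (u + v).
Proof.
move=> [fi fu] [gi gv]; split.
  have -> : EFin \o (fun w => f w + g w) = ((EFin \o f) \+ (EFin \o g))%E by [].
  by apply: integrableD.
under eq_integral do rewrite EFinD.
by rewrite integralD// fu gv.
Qed.

Lemma has_meanZ c f u : has_mean f u -> has_mean (fun w => c * f w) (c * u).
Proof.
move=> [fi fu]; split.
  have -> : EFin \o (fun w => c * f w) = (fun w => c%:E * (EFin \o f) w)%E by [].
  by apply: integrableZl.
under eq_integral do rewrite EFinM.
by rewrite integralZl// fu.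
Qed.

Lemma has_meanB f g u v :
  has_mean f u -> has_mean g v -> has_mean (fun w => f w - g w) (u - v).
Proof.
move=> hf /(has_meanZ (-1)) /(has_meanD _ _ _ _ hf).
by rewrite mulN1r; under eq_fun do rewrite mulN1r.
Qed.

Lemma has_mean0 : has_mean (fun=> 0) 0.
Proof. by split; [exact: integrable0|exact: integral0]. Qed.

Lemma has_mean_sum (I : Type) (s : seq I) (f : I -> config -> R) v :
  (forall i, has_mean (f i) (v i)) ->
  has_mean (fun w => \sum_(i <- s) f i w) (\sum_(i <- s) v i).
Proof.
move=> h; elim: s => [|i s IHs].
  by rewrite big_nil; under eq_fun do rewrite big_nil; exact: has_mean0.
by rewrite big_cons; under eq_fun do rewrite big_cons; exact: has_meanD.
Qed.

Lemma has_mean_indic s b v :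
  mu (cyl_event s b) = v%:E -> has_mean (\1_(cyl_event s b)) v.
Proof.
move=> Av; have mA := measurable_cyl_event s b; split.
  exact: integrable_indic.
by rewrite integral_indic// setIT.
Qed.

(** Enumerating the integers turns sums over [int] into series over [nat], where countable
    additivity and linearity are available. *)
Lemma card_int : ([set: int] #= [set: nat])%card.
Proof.
apply: eq_card_nat => //; apply/infiniteP/pcard_leTP/injPex.
by exists Posz => // m n _ _ [].
Qed.

(** The value of coordinate [j] splits the space into countably many pieces, and [f (w j)] is
    constant on each of them. *)
Lemma integral_coord (f : int -> R) j (A : set Omega) : measurable A ->
  (forall z, 0 <= f z) ->
  (\int[mu]_(w in [set: Omega]) (f (w j) * \1_A w)%:E =
   \esum_(z in [set: int]) ((f z)%:E * mu (A `&` coord_event j [set z])))%E.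
Proof.
move=> mA f0.
have /card_set_bijP[e ebij] : ([set: nat] #= [set: int])%card by rewrite card_eq_sym card_int.
rewrite (reindex_esum _ _ _ _ ebij) -nneseries_esumT; last first.
  by move=> n; rewrite mule_ge0// lee_fin.
pose F n : set Omega := coord_event j [set e n].
have FT : \bigcup_n F n = [set: Omega].
  apply/seteqP; split => // w _.
  have [_ _ /(_ (w j) I)[n _ en]] := ebij.
  by exists n => //; rewrite /F /coord_event /= en.
have mf : measurable_fun [set: Omega] ((fun w : Omega => (f (w j) * \1_A w)%:E) : Omega -> \bar R).
  apply/measurable_EFinP; apply: measurable_funM; last exact: measurable_indic.
  move=> _ B _; rewrite setTI.
  exact: (measurable_coord_event j (f @^-1` B)).
rewrite -FT ge0_integral_bigcup ?FT//; first last.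
- move=> m n _ _ [w [/= wm wn]]; have [_ inj _] := ebij.
  by apply: inj; rewrite ?inE// -wm -wn.
- by move=> w _; rewrite lee_fin mulr_ge0.
- by move=> n; exact: measurable_coord_event.
apply: eq_eseriesr => n _.
rewrite -(@integral_indic _ Omega)//; last exact: measurable_coord_event.
rewrite -ge0_integralZl_EFin//; last 2 first.
- exact: measurable_coord_event.
- by apply/measurable_EFinP/measurable_indic.
by apply: eq_integral => w; rewrite inE => wn; rewrite EFinM wn.
Qed.

End Mean.

(** * Site marginals *)

Section SiteMarginal.
Context {R : realType} (r : int -> R) (hr : rate_function r).

Lemma rate_gt0 z : 0 < r z.
Proof. by case: hr. Qed.

Lemma rate_ge0 z : 0 <= r z.
Proof. exact/ltW/rate_gt0. Qed.

Lemma rate_le x y : x <= y -> r x <= r y.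
Proof. by case: hr => _ + _ _; exact. Qed.

Lemma rateN z : r (- z) = (r (z + 1))^-1.
Proof.
case: hr => _ _ _ /(_ (z + 1)).
rewrite opprD addrCA subrr addr0 => h.
by rewrite -[RHS]mulr1 -h mulKf// gt_eqF// rate_gt0.
Qed.

Lemma rate_reflect z : r z * r (1 - z) = 1.
Proof. by case: hr. Qed.

Lemma rfact_gt0 n : 0 < rfact r n.
Proof. by apply: prodr_gt0 => i _; exact: rate_gt0. Qed.

Lemma rfactS n : rfact r n.+1 = rfact r n * r n.+1%:Z.
Proof. by rewrite /rfact big_nat_recr. Qed.

Lemma site_weight_gt0 t z : 0 < site_weight r t z.
Proof. by rewrite divr_gt0 ?expR_gt0 ?rfact_gt0. Qed.

(** One recursion covers both signs of [z]: for [z >= 0] the factorial gains [r (z + 1)], the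
    inverse of [r (- z)], and for [z < 0] it loses the factor [r (- z)]. *)
Lemma site_weight_succ t z :
  site_weight r t (z + 1) = expR t * r (- z) * site_weight r t z.
Proof.
have E : expR (t * (z + 1)%:~R) = expR t * expR (t * z%:~R) :> R.
  by rewrite -expRD; congr expR; rewrite intrD mulrDr mulr1 addrC.
rewrite /site_weight E; case: z {E} => n.
  have -> : (Posz n + 1)%R = Posz n.+1 by lia.
  rewrite rateN !absz_nat rfactS; have -> : (Posz n + 1)%R = Posz n.+1 by lia.
  by rewrite invfM; ring.
have -> : (Negz n + 1)%R = - Posz n by rewrite NegzE; lia.
rewrite NegzE opprK !abszN !absz_nat rfactS invfM.
have := rate_gt0 n.+1%:Z; have := rfact_gt0 n => h1 h2.
by field; rewrite !gt_eqF.
Qed.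

End SiteMarginal.

(** * Cylinder probabilities and means of rates under the product measure *)

Section ProductMeasure.
Context {R : realType} (r theta : int -> R) (mu : probability Omega R).
Context (hr : rate_function r) (hmu : is_product_measure r theta mu).

Local Notation p := (fun i z => site_pmf r (theta i) z).

Definition cyl_prob (s : seq int) (b : config) : R := \prod_(i <- s) p i (b i).

Lemma mu_cyl_event s b : uniq s -> mu (cyl_event s b) = (cyl_prob s b)%:E.
Proof.
move=> us; have [ind marg] := hmu.
have perm : perm_eq [fset i in s]%fset s.
  by apply: uniq_perm => // i; rewrite in_fset.
have -> : cyl_event s b =
    \bigcap_(i in [set` [fset i in s]%fset]) coord_event i [set b i].
  apply/seteqP; split => w /=.
    by move=> h i /=; rewrite in_fset; exact: h.
  by move=> h i si; apply: (h i) => /=; rewrite in_fset.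
rewrite (ind _ (fun i => [set b i])) (perm_big _ perm)/= /cyl_prob -prodEFin.
by apply: eq_bigr => i _; exact: marg.
Qed.

(** The sum is the total mass of [mu], split according to coordinate [i]; the partition function is
    never estimated. *)
Lemma site_pmf_total i : (\esum_(z in [set: int]) (p i z)%:E = 1)%E.
Proof.
have := integral_coord mu (fun=> 1) i [set: Omega] measurableT (fun=> ler01).
under eq_integral do rewrite mul1r.
rewrite integral_indic// setIT => E.
apply: etrans (etrans _ (esym E)) (probability_setT mu).
by apply: eq_esum => z _; rewrite mul1e setTI; have [_ ->] := hmu.
Qed.

Lemma site_pmf_gt0 i z : 0 < p i z.
Proof.
rewrite mulr_gt0 ?site_weight_gt0// lt_neqAle.
apply/andP; split; last first.
  rewrite invr_ge0 fine_ge0// esum_ge0// => x _.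
  by rewrite lee_fin ltW// site_weight_gt0.
(* A zero normalising factor, also the default value when the partition function is infinite, would
   make every mass vanish and contradict total mass one. *)
apply/eqP => c0; have := site_pmf_total i.
rewrite esum1 => [/eqP|x _]; first by rewrite lt_eqF.
by rewrite /site_pmf -c0 mul0r.
Qed.

Lemma site_pmf_succ i z : p i (z + 1) = expR (theta i) * r (- z) * p i z.
Proof. by rewrite /site_pmf site_weight_succ// mulrCA. Qed.

(** This balance relation absorbs the rate into a shift of the law; all explicit means and inflows
    below rest on it. *)
Lemma site_pmf_rate i z : r z * p i z = expR (theta i) * p i (z - 1).
Proof.
have := site_pmf_succ i (z - 1); rewrite subrK => ->.
have -> : - (z - 1) = 1 - z by rewrite opprB.
transitivity (r z * r (1 - z) * (expR (theta i) * p i (z - 1))); first ring.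
by rewrite rate_reflect// mul1r.
Qed.

Lemma site_pmf_pred i z : p i (z - 1) = expR (- theta i) * r z * p i z.
Proof.
by rewrite -mulrA site_pmf_rate mulrA -expRD addNr expR0 mul1r.
Qed.

Lemma site_pmf_total_shift i c :
  (\esum_(z in [set: int]) (p i (z + c))%:E = 1)%E.
Proof.
rewrite -(site_pmf_total i).
rewrite [RHS](reindex_esum [set: int] _ (fun z => z + c))//; split => //.
  by move=> x y _ _ /addIr.
by move=> y _; exists (y - c) => //; rewrite subrK.
Qed.

Lemma esumZ (c : R) (f : int -> R) : 0 <= c -> (forall z, 0 <= f z) ->
  (\esum_(z in [set: int]) (c * f z)%:E = c%:E * \esum_(z in [set: int]) (f z)%:E)%E.
Proof.
move=> c0 f0.
have /card_set_bijP[e ebij] : ([set: nat] #= [set: int])%card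
  by rewrite card_eq_sym card_int.
rewrite 2!(reindex_esum _ _ _ _ ebij) -!nneseries_esumT.
- by rewrite -nneseriesZl// => n _; rewrite lee_fin.
- by move=> n; rewrite lee_fin.
- by move=> n; rewrite lee_fin mulr_ge0.
Qed.

(** After [site_pmf_rate] the mean is [expR (theta i)] times a shifted total mass, so it is finite
    however fast [r] grows. *)
Lemma mean_rate i : (\esum_(z in [set: int]) (r z * p i z)%:E = (expR (theta i))%:E)%E.
Proof.
under eq_esum do rewrite site_pmf_rate.
rewrite esumZ ?expR_ge0// => [|z]; last exact/ltW/site_pmf_gt0.
by rewrite site_pmf_total_shift mule1.
Qed.

Lemma mean_rateN i :
  (\esum_(z in [set: int]) (r (- z) * p i z)%:E = (expR (- theta i))%:E)%E.
Proof.
have E z : r (- z) * p i z = expR (- theta i) * p i (z + 1).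
  by rewrite site_pmf_succ !mulrA -expRD addNr expR0 mul1r.
under eq_esum do rewrite E.
rewrite esumZ ?expR_ge0// => [|z]; last exact/ltW/site_pmf_gt0.
by rewrite site_pmf_total_shift mule1.
Qed.

Lemma has_mean_cyl s b : uniq s -> has_mean mu (\1_(cyl_event s b)) (cyl_prob s b).
Proof. by move=> us; apply: has_mean_indic; exact: mu_cyl_event. Qed.

Lemma has_mean_inside (f : int -> R) j s b : uniq s -> j \in s ->
  has_mean mu (fun w => f (w j) * \1_(cyl_event s b) w) (f (b j) * cyl_prob s b).
Proof.
move=> us sj; rewrite (_ : (fun w => _) = (fun w => f (b j) * \1_(cyl_event s b) w)).
  exact/has_meanZ/has_mean_cyl.
apply/funext => w; rewrite indicE; case: (boolP (w \in _)) => [|_].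
  by rewrite inE => /(_ j sj) ->.
by rewrite !mulr0.
Qed.

(** A coordinate outside [s] is independent of the cylinder event, so the mean factorises. *)
Lemma has_mean_outside (f : int -> R) j s b v : (forall z, 0 <= f z) ->
  (\esum_(z in [set: int]) (f z * p j z)%:E = v%:E)%E ->
  uniq s -> j \notin s ->
  has_mean mu (fun w => f (w j) * \1_(cyl_event s b) w) (v * cyl_prob s b).
Proof.
move=> f0 fv us sj.
have P0 : 0 <= cyl_prob s b.
  by apply: prodr_ge0 => i _; exact/ltW/site_pmf_gt0.
have E : (\int[mu]_(w in [set: Omega]) (f (w j) * \1_(cyl_event s b) w)%:E =
  (v * cyl_prob s b)%:E)%E.
  rewrite (integral_coord _ _ _ _ (measurable_cyl_event s b))//.
  rewrite EFinM -fv muleC -esumZ// => [|z]; last by rewrite mulr_ge0// ltW// site_pmf_gt0.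
  apply: eq_esum => z _.
  (* Fixing [w j = z] in addition gives a cylinder event over [j :: s], whose probability is again a
     product. *)
  pose b' : config := fun i => if i == j then z else b i.
  have -> : cyl_event s b `&` coord_event j [set z] = cyl_event (j :: s) b'.
    rewrite cyl_event_cons setIC /b' eqxx; congr (_ `&` _).
    apply/seteqP; split => w h i si; rewrite /b' ?h//; last have := h i si.
      by case: eqP => // ij; move: si; rewrite ij (negbTE sj).
    by rewrite /b'; case: eqP => // ij; move: si; rewrite ij (negbTE sj).
  rewrite mu_cyl_event ?cons_uniq ?sj// -EFinM; congr _%:E.
  have -> : cyl_prob s b = \prod_(i <- s) p i (b' i).
    apply: eq_big_seq => i si; rewrite /b'.
    by case: eqP => // ij; move: si; rewrite ij (negbTE sj).
  by rewrite /cyl_prob big_cons {1}/b' eqxx; ring.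
split => //; apply/integrableP; split.
  apply/measurable_EFinP; apply: measurable_funM.
    by move=> _ B _; rewrite setTI; exact: (measurable_coord_event j (f @^-1` B)).
  by apply: measurable_indic; exact: measurable_cyl_event.
rewrite (eq_integral (fun w : Omega => (f (w j) * \1_(cyl_event s b) w)%:E)) => [|w _].
  by rewrite E ltry.
by rewrite gee0_abs// lee_fin mulr_ge0.
Qed.

End ProductMeasure.

(** * The generator on indicators of cylinders *)

(** The inverse of [lay_brick i], used to pull cylinder events back. *)
Definition take_brick (i : int) (b : config) : config :=
  fun j => if j == i then b j + 1 else if j == i + 1 then b j - 1 else b j.

Lemma take_brick_l i b : take_brick i b i = b i + 1.
Proof. by rewrite /take_brick eqxx. Qed.

Lemma take_brick_r i b : take_brick i b (i + 1) = b (i + 1) - 1.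
Proof. by rewrite /take_brick eqxx; case: eqVneq => //; lia. Qed.

Lemma cyl_event_lay_brick s b i w :
  cyl_event s b (lay_brick i w) <-> cyl_event s (take_brick i b) w.
Proof.
by split => h j sj; have := h j sj; rewrite /lay_brick /take_brick;
  do 2?[case: eqVneq => // _]; lia.
Qed.

Lemma cyl_event_shift s b k w :
  cyl_event s b (shift_config k w) <->
  cyl_event [seq j - k | j <- s] (shift_config (- k) b) w.
Proof.
split => h j.
  move=> /mapP[i si ->]; have := h i si; rewrite /shift_config => ->.
  by congr b; lia.
move=> sj; have := h (j - k) (map_f _ sj); rewrite /shift_config => ->.
by rewrite opprK subrK.
Qed.

Section IndicatorChange.
Context {R : realType}.

Lemma indic_lay_brick s b i w :
  \1_(cyl_event s b) (lay_brick i w) = \1_(cyl_event s (take_brick i b)) w :> R.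
Proof.
rewrite !indicE; congr ((nat_of_bool _)%:R).
by apply/idP/idP; rewrite !inE => /(cyl_event_lay_brick s b i w).
Qed.

Lemma indic_shift s b k w :
  \1_(cyl_event s b) (shift_config k w) =
  \1_(cyl_event [seq j - k | j <- s] (shift_config (- k) b)) w :> R.
Proof.
rewrite !indicE; congr ((nat_of_bool _)%:R).
by apply/idP/idP; rewrite !inE => /(cyl_event_shift s b k w).
Qed.

(** Writes a factor attached to one site as a product over [s], so that it can be merged factor by
    factor with a cylinder probability. *)
Lemma prodr_single (s : seq int) i (c : R) : uniq s ->
  \prod_(j <- s) (if j == i then c else 1) = if i \in s then c else 1.
Proof.
elim: s => [|k s IHs]; first by rewrite big_nil.
rewrite cons_uniq big_cons inE => /andP[ks /IHs->].
rewrite eq_sym; case: eqVneq => [->|_]; last by rewrite mul1r.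
by rewrite (negbTE ks) mulr1.
Qed.

End IndicatorChange.

Section GeneratorOnCylinders.
Context {R : realType} (r theta : int -> R) (mu : probability Omega R).
Context (hr : rate_function r) (hmu : is_product_measure r theta mu).

Local Notation p := (fun i z => site_pmf r (theta i) z).
Local Notation P := (cyl_prob r theta).

(** The conditional mean of [r (w j)] given the cylinder event: frozen inside [s], the unconditional
    mean outside. *)
Definition cond_rate (s : seq int) (b : config) j : R :=
  if j \in s then r (b j) else expR (theta j).

Definition cond_rateN (s : seq int) (b : config) j : R :=
  if j \in s then r (- b j) else expR (- theta j).

Lemma has_mean_rate s b j : uniq s ->
  has_mean mu (fun w => r (w j) * \1_(cyl_event s b) w) (cond_rate s b j * P s b).
Proof.
move=> us; rewrite /cond_rate; case: ifPn => sj; first exact: has_mean_inside.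
apply: (has_mean_outside _ _ _ hr hmu r) => //; last exact: (mean_rate _ _ _ hr hmu).
by move=> z; exact: rate_ge0.
Qed.

Lemma has_mean_rateN s b j : uniq s ->
  has_mean mu (fun w => r (- w j) * \1_(cyl_event s b) w) (cond_rateN s b j * P s b).
Proof.
move=> us; rewrite /cond_rateN; case: ifPn => sj.
  exact: (has_mean_inside _ _ _ hmu (fun z => r (- z))).
apply: (has_mean_outside _ _ _ hr hmu (fun z => r (- z))) => //.
  by move=> z; exact: rate_ge0.
exact: (mean_rateN _ _ _ hr hmu).
Qed.

(** Only the factors at [i] and [i + 1] change, by [site_pmf_succ] and [site_pmf_pred]. *)
Lemma cyl_prob_take_brick s b i : uniq s ->
  P s (take_brick i b) =
  expR (theta i - theta (i + 1)) * cond_rateN s b i * cond_rate s b (i + 1) * P s b.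
Proof.
move=> us.
(* At a site outside [s] the mean rate cancels its half of the exponential, so one formula also
   covers bonds that cross the edge of [s]. *)
have -> : expR (theta i - theta (i + 1)) * cond_rateN s b i * cond_rate s b (i + 1) =
  (if i \in s then expR (theta i) * r (- b i) else 1) *
  (if i + 1 \in s then expR (- theta (i + 1)) * r (b (i + 1)) else 1).
  rewrite expRD /cond_rate /cond_rateN.
  have e1 j : expR (theta j) * expR (- theta j) = 1 by rewrite -expRD subrr expR0.
  have ei := e1 i; have ei1 := e1 (i + 1).
  case: ifP => _; case: ifP => _; first ring.
  - by rewrite mulr1 -[RHS]mulr1 -ei1; ring.
  - by rewrite mul1r -[RHS]mulr1 -ei; ring.
  - by rewrite -{1}ei -ei1; ring.
rewrite -!prodr_single// -!big_split/=; apply: eq_bigr => j _.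
rewrite /take_brick; case: eqVneq => [->|_].
  by case: eqVneq => [|_]; [lia|rewrite site_pmf_succ// mulr1].
by case: eqVneq => [->|_]; rewrite ?site_pmf_pred// !mul1r.
Qed.

Lemma cond_rate_take_brick s b i :
  cond_rate s (take_brick i b) i * cond_rateN s b i = 1.
Proof.
rewrite /cond_rate /cond_rateN; case: ifP => _; last by rewrite -expRD subrr expR0.
by rewrite take_brick_l rateN// divff// gt_eqF// rate_gt0.
Qed.

Lemma cond_rateN_take_brick s b i :
  cond_rateN s (take_brick i b) (i + 1) * cond_rate s b (i + 1) = 1.
Proof.
rewrite /cond_rate /cond_rateN; case: ifP => _; last by rewrite -expRD addNr expR0.
by rewrite take_brick_r rateN// subrK mulVf// gt_eqF// rate_gt0.
Qed.

(** Inflow minus outflow of the cylinder event through the bond from [i] to [i + 1], divided by the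
    probability of the event. In the inflow each rate cancels one of the two factors of
    [cyl_prob_take_brick]. *)
Definition bond_flow s b i : R :=
  expR (theta i - theta (i + 1)) * (cond_rate s b (i + 1) + cond_rateN s b i)
  - cond_rate s b i - cond_rateN s b (i + 1).

Lemma has_mean_bond s b i : uniq s ->
  let phi := \1_(cyl_event s b) : config -> R in
  has_mean mu (fun w => (r (w i) + r (- w (i + 1))) * (phi (lay_brick i w) - phi w))
    (P s b * bond_flow s b i).
Proof.
move=> us phi.
have h := has_meanB _ _ _ _ _
  (has_meanD _ _ _ _ _ (has_mean_rate s (take_brick i b) i us)
                       (has_mean_rateN s (take_brick i b) (i + 1) us))
  (has_meanD _ _ _ _ _ (has_mean_rate s b i us) (has_mean_rateN s b (i + 1) us)).
congr (has_mean mu _ _) : h.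
  apply/funext => w; rewrite /phi indic_lay_brick; ring.
rewrite cyl_prob_take_brick// /bond_flow.
have h1 := cond_rate_take_brick s b i; have h2 := cond_rateN_take_brick s b i.
set E := expR _; set A := cond_rate _ _ i in h1 *; set A' := cond_rateN s _ i in h1 *.
set B := cond_rateN _ _ (i + 1) in h2 *; set B' := cond_rate s _ (i + 1) in h2 *.
transitivity (P s b * (E * (B' * (A * A') + A' * (B * B'))
  - cond_rate s b i - cond_rateN s b (i + 1))).
  ring.
by rewrite h1 h2 !mulr1.
Qed.

(** At the bond from [-1] to [0] the generator has [r (- w 0 - 1)] where other bonds would have
    [r (- w 0)]. Treating the difference as a separate term lets all bonds be summed uniformly. *)
Lemma has_mean_tracer_correction s b : uniq s -> 0 \in s -> -1 \in s ->
  let phi := \1_(cyl_event s b) : config -> R in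
  has_mean mu (fun w => (r (- w 0 - 1) - r (- w 0)) * (phi (lay_brick (-1) w) - phi w))
    (P s b * (expR (theta (-1) - theta 0) * r (- b (-1)) * (r (b 0) * r (- b 0) - 1)
              - r (- b 0 - 1) + r (- b 0))).
Proof.
move=> us s0 s1 phi.
have h := has_meanB _ _ _ _ _
  (has_mean_inside _ _ _ hmu (fun z => r (- z - 1) - r (- z)) 0 s (take_brick (-1) b) us s0)
  (has_mean_inside _ _ _ hmu (fun z => r (- z - 1) - r (- z)) 0 s b us s0).
congr (has_mean mu _ _) : h.
  apply/funext => w; rewrite /phi indic_lay_brick; ring.
rewrite cyl_prob_take_brick// /cond_rate /cond_rateN (_ : -1 + 1 = 0)// s0 s1.
have -> : take_brick (-1) b 0 = b 0 - 1 by [].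
have -> : - (b 0 - 1) - 1 = - b 0 by lia.
have -> : - (b 0 - 1) = 1 - b 0 by lia.
set E := expR _; have h := rate_reflect _ hr (b 0).
transitivity (P s b * (E * r (- b (-1)) * (r (b 0) * r (- b 0) - r (b 0) * r (1 - b 0))
   - r (- b 0 - 1) + r (- b 0))); first ring.
by rewrite h.
Qed.

(** The density of the shifted product measure with respect to the original one, on the sites of
    [s]: the shift gives site [j] the parameter of site [j - k]. *)
Definition shift_density k (s : seq int) (b : config) : R :=
  \prod_(j <- s) (p (j - k) (b j) / p j (b j)).

Lemma cyl_prob_shift k s b :
  P [seq j - k | j <- s] (shift_config (- k) b) = shift_density k s b * P s b.
Proof.
rewrite /cyl_prob /shift_density big_map -big_split/=; apply: eq_bigr => j _.
have p0 := site_pmf_gt0 _ _ _ hr hmu j (b j).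
by rewrite divfK ?gt_eqF// /shift_config opprK subrK.
Qed.

Lemma has_mean_tracer_left s b : uniq s -> 0 \in s -> 1 \in s ->
  let phi := \1_(cyl_event s b) : config -> R in
  has_mean mu (fun w => (r (- w 0) - r (- w 0 - 1)) *
                        (phi (shift_config 1 (lay_brick (-1) w)) - phi w))
    (P s b * (expR (theta (-1) - theta 0) * (1 - r (b 1) * r (- b 1)) * r (- b 0)
                * shift_density 1 s b
              - r (- b 0) + r (- b 0 - 1))).
Proof.
move=> us s0 s1 phi.
(* The pulled-back event lives on [s'], where [b 0] and [b 1] stand at sites [-1] and [0]; hence
   both sites must belong to [s]. *)
pose s' := [seq j - 1 | j <- s]; pose c := shift_config (- 1) b.
have us' : uniq s' by rewrite map_inj_uniq// => i j /addIr.
have s'0 : 0 \in s' by apply/mapP; exists 1.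
have s'1 : -1 \in s' by apply/mapP; exists 0.
have h := has_meanB _ _ _ _ _
  (has_mean_inside _ _ _ hmu (fun z => r (- z) - r (- z - 1)) 0 s' (take_brick (-1) c) us' s'0)
  (has_mean_inside _ _ _ hmu (fun z => r (- z) - r (- z - 1)) 0 s b us s0).
congr (has_mean mu _ _) : h.
  by apply/funext => w; rewrite /phi indic_shift indic_lay_brick; ring.
rewrite cyl_prob_take_brick// cyl_prob_shift /cond_rate /cond_rateN (_ : -1 + 1 = 0)//.
rewrite s'0 s'1.
have -> : take_brick (-1) c 0 = b 1 - 1 by [].
have -> : c 0 = b 1 by [].
have -> : c (-1) = b 0 by [].
have -> : - (b 1 - 1) - 1 = - b 1 by lia.
have -> : - (b 1 - 1) = 1 - b 1 by lia.
set E := expR _; have h := rate_reflect _ hr (b 1); rewrite -h; ring.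
Qed.

Lemma has_mean_tracer_right s b : uniq s -> 0 \in s -> -1 \in s ->
  let phi := \1_(cyl_event s b) : config -> R in
  has_mean mu (fun w => (r (w 0 + 1) - r (w 0)) * (phi (shift_config (-1) w) - phi w))
    (P s b * ((r (b (-1) + 1) - r (b (-1))) * shift_density (-1) s b
              - r (b 0 + 1) + r (b 0))).
Proof.
move=> us s0 s1 phi.
pose s' := [seq j - (-1) | j <- s]; pose c := shift_config (- -1) b.
have us' : uniq s' by rewrite map_inj_uniq// => i j /addIr.
have s'0 : 0 \in s' by apply/mapP; exists (-1).
have h := has_meanB _ _ _ _ _
  (has_mean_inside _ _ _ hmu (fun z => r (z + 1) - r z) 0 s' c us' s'0)
  (has_mean_inside _ _ _ hmu (fun z => r (z + 1) - r z) 0 s b us s0).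
congr (has_mean mu _ _) : h.
  by apply/funext => w; rewrite /phi indic_shift; ring.
rewrite cyl_prob_shift (_ : c 0 = b (-1))//; ring.
Qed.

End GeneratorOnCylinders.

(** * Windows and the bonds that touch them *)

Definition zseq (m : int) (k : nat) : seq int := [seq m + j%:Z | j <- iota 0 k].

Lemma zseq_uniq m k : uniq (zseq m k).
Proof. by rewrite map_inj_uniq ?iota_uniq// => i j /addrI[]. Qed.

Lemma mem_zseq m k i : (i \in zseq m k) = (m <= i < m + k%:Z).
Proof.
apply/mapP/idP => [[j]|mi]; first by rewrite mem_iota => ? ->; lia.
by exists `|i - m|%N; rewrite ?mem_iota; lia.
Qed.

Definition window (n : nat) := zseq (- n%:Z) n.*2.+1.

(** A bond is named by its left end, so the list starts one site to the left of the window, at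
    [- n - 1], and ends at [n]. *)
Definition window_bonds (n : nat) := zseq (- n.+1%:Z) n.*2.+2.

Lemma mem_window n i : (i \in window n) = (- n%:Z <= i <= n%:Z).
Proof. by rewrite mem_zseq -addnn; lia. Qed.

Lemma mem_window_bonds n i :
  (i \in window_bonds n) = (i \in window n) || (i + 1 \in window n).
Proof. by rewrite mem_zseq !mem_window -addnn; lia. Qed.

Lemma window_uniq n : uniq (window n).
Proof. exact: zseq_uniq. Qed.

Definition window_dependent {R : realType} (n : nat) (phi : config -> R) : Prop :=
  forall w w' : config, (forall i, i \in window n -> w i = w' i) -> phi w = phi w'.

Lemma window_dependent_indic {R : realType} n b :
  window_dependent n (\1_(cyl_event (window n) b) : config -> R).
Proof.
move=> w w' ww; rewrite !indicE; congr ((nat_of_bool _)%:R).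
by apply/idP/idP; rewrite !inE => h i wi; rewrite -(h i wi) ww.
Qed.

(** Replaces the finitely supported sum by a list sum that includes the two exceptional bonds, at
    the price of the correction term for bond [-1]. *)
Lemma generator_windowE {R : realType} (r : int -> R) (phi : config -> R) n :
  (0 < n)%N ->
  window_dependent n phi ->
  generator r phi = fun w =>
  \sum_(i <- window_bonds n)
     (r (w i) + r (- w (i + 1))) * (phi (lay_brick i w) - phi w)
  + (r (- w 0 - 1) - r (- w 0)) * (phi (lay_brick (-1) w) - phi w)
  + (r (- w 0) - r (- w 0 - 1)) * (phi (shift_config 1 (lay_brick (-1) w)) - phi w)
  + (r (w 0 + 1) - r (w 0)) * (phi (shift_config (-1) w) - phi w).
Proof.
move=> n0 phin; apply/funext => w; rewrite /generator.
set f := fun i => (r (w i) + r (- w (i + 1))) * (phi (lay_brick i w) - phi w).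
(* Laying a brick on such a bond changes no coordinate in the window. *)
have out i : i \notin window_bonds n -> f i = 0.
  rewrite mem_window_bonds negb_or => /andP[wi wi1].
  rewrite /f (phin _ w) ?subrr ?mulr0// => j wj; rewrite /lay_brick.
  case: eqVneq => [ji|_]; first by rewrite -ji wj in wi.
  by case: eqVneq => [ji|//]; rewrite -ji wj in wi1.
have b0 : 0 \in window_bonds n by rewrite mem_window_bonds !mem_window; lia.
have b1 : -1 \in window_bonds n by rewrite mem_window_bonds !mem_window; lia.
have -> : \sum_(i \in [set i : int | i != -1 /\ i != 0]) f i =
    \sum_(i <- window_bonds n | (i != -1) && (i != 0)) f i.
  rewrite fsbig_mkcond -(fsbig_widen [set` window_bonds n])//; last first.
    move=> i [_ /= /negP iw]; rewrite /patch; case: ifP => // _; exact: out.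
  rewrite -fsbig_seq ?zseq_uniq// [RHS]big_mkcond; apply: eq_bigr => i _.
  rewrite /patch; congr (if _ then _ else _).
  by apply/idP/idP; rewrite inE => /andP.
rewrite (bigD1_seq _ b1) ?zseq_uniq//=.
rewrite [X in _ = _ + X + _ + _ + _]big_mkcond (bigD1_seq _ b0) ?zseq_uniq//= -big_mkcondr.
under [in RHS]eq_bigl do rewrite andbC.
rewrite /f (_ : -1 + 1 = 0)// (_ : 0 + 1 = 1)//; ring.
Qed.

(** * Total flow into a window event *)

Section WindowFlow.
Context {R : realType} (r theta : int -> R) (mu : probability Omega R).
Context (hr : rate_function r) (hmu : is_product_measure r theta mu).

(** What the bonds on the two sides of [j] contribute through the value [z] at [j]; it vanishes
    where [theta] is locally constant. *)
Definition site_flow (j z : int) : R :=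
  (expR (theta (j - 1) - theta j) - 1) * r z
  + (expR (theta j - theta (j + 1)) - 1) * r (- z).

Definition boundary_flow (n : nat) : R :=
  expR (theta n) - expR (- theta (n%:Z + 1))
  + (expR (- theta (- n%:Z)) - expR (theta (- n%:Z - 1))).

Lemma sum_bond_flow n b :
  \sum_(i <- window_bonds n) bond_flow r theta (window n) b i =
  boundary_flow n + \sum_(j <- window n) site_flow j (b j).
Proof.
(* Each bond flow splits into a part [U] at its right end and a part [V] at its left end. Regrouping
   by sites leaves [U (n + 1)] and [V (- n - 1)] unpaired, and these form [boundary_flow]. *)
pose U i := expR (theta (i - 1) - theta i) * cond_rate r theta (window n) b i
  - cond_rateN r theta (window n) b i.
pose V i := expR (theta i - theta (i + 1)) * cond_rateN r theta (window n) b i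
  - cond_rate r theta (window n) b i.
have out i : i \notin window n ->
    cond_rate r theta (window n) b i = expR (theta i) /\
    cond_rateN r theta (window n) b i = expR (- theta i).
  by rewrite /cond_rate /cond_rateN => /negbTE->.
transitivity (\sum_(i <- window_bonds n) (U (i + 1) + V i)).
  apply: eq_bigr => i _; rewrite /bond_flow /U /V addrK; ring.
rewrite big_split /window_bonds /window /zseq !big_map.
rewrite -[iota 0 _.+2]/(index_iota 0 n.*2.+2) -[iota 0 _.+1]/(index_iota 0 n.*2.+1).
rewrite big_nat_recr//= [X in _ + X]big_nat_recl//=.
have -> : - n.+1%:Z + n.*2.+1%:Z + 1 = n%:Z + 1 by rewrite -addnn; lia.
have -> : - n.+1%:Z + 0%:Z = - n%:Z - 1 by lia.
have arr (A u v B : R) : A + u + (v + B) = u + v + (A + B) by ring.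
rewrite {}arr; congr (_ + _); last first.
  rewrite -big_split; apply: eq_big_nat => k /andP[_ kn] /=.
  have -> : - n.+1%:Z + k%:Z + 1 = - n%:Z + k%:Z by lia.
  have -> : - n.+1%:Z + k.+1%:Z = - n%:Z + k%:Z by lia.
  have kw : - n%:Z + k%:Z \in window n by rewrite mem_window; lia.
  rewrite /U /V /site_flow /cond_rate /cond_rateN kw; ring.
have [e1 e2] : cond_rate r theta (window n) b (n%:Z + 1) = expR (theta (n%:Z + 1)) /\
    cond_rateN r theta (window n) b (n%:Z + 1) = expR (- theta (n%:Z + 1)).
  by apply: out; rewrite mem_window; lia.
have [e3 e4] : cond_rate r theta (window n) b (- n%:Z - 1) = expR (theta (- n%:Z - 1)) /\
    cond_rateN r theta (window n) b (- n%:Z - 1) = expR (- theta (- n%:Z - 1)).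
  by apply: out; rewrite mem_window; lia.
have -> : U (n%:Z + 1) = expR (theta n) - expR (- theta (n%:Z + 1)).
  by rewrite /U e1 e2 addrK -expRD subrK.
have -> : V (- n%:Z - 1) = expR (- theta (- n%:Z)) - expR (theta (- n%:Z - 1)).
  by rewrite /V e3 e4 subrK -expRD addrAC subrr add0r.
by [].
Qed.

Definition window_flow (n : nat) (b : config) : R :=
  boundary_flow n + \sum_(j <- window n) site_flow j (b j)
  + expR (theta (-1) - theta 0) * r (- b (-1)) * (r (b 0) * r (- b 0) - 1)
  + expR (theta (-1) - theta 0) * (1 - r (b 1) * r (- b 1)) * r (- b 0)
      * shift_density r theta 1 (window n) b
  + (r (b (-1) + 1) - r (b (-1))) * shift_density r theta (-1) (window n) b
  - r (b 0 + 1) + r (b 0).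

Lemma has_mean_generator n b : (0 < n)%N ->
  has_mean mu (generator r \1_(cyl_event (window n) b))
    (cyl_prob r theta (window n) b * window_flow n b).
Proof.
move=> n0; have un := window_uniq n.
have w0 : 0 \in window n by rewrite mem_window; lia.
have w1 : 1 \in window n by rewrite mem_window; lia.
have w2 : -1 \in window n by rewrite mem_window; lia.
rewrite (generator_windowE _ _ n)//; last exact: window_dependent_indic.
have h := has_meanD _ _ _ _ _ (has_meanD _ _ _ _ _ (has_meanD _ _ _ _ _
  (has_mean_sum _ _ (window_bonds n) _ _
     (fun i => has_mean_bond _ _ _ hr hmu (window n) b i un))
  (has_mean_tracer_correction _ _ _ hr hmu _ b un w0 w2))
  (has_mean_tracer_left _ _ _ hr hmu _ b un w0 w1))
  (has_mean_tracer_right _ _ _ hr hmu _ b un w0 w2).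
congr (has_mean mu _ _) : h; rewrite -mulr_sumr sum_bond_flow /window_flow; ring.
Qed.

Lemma bounded_cylinder_indic s b :
  bounded_cylinder (\1_(cyl_event s b) : config -> R).
Proof.
split.
  exists [fset i in s]%fset => w w' ww; rewrite !indicE; congr ((nat_of_bool _)%:R).
  by apply/idP/idP; rewrite !inE => h i si; rewrite -(h i si) ww// in_fset.
by exists 1 => w; rewrite indicE; case: (_ \in _); rewrite ?normr0 ?normr1.
Qed.

(** The mean is the flow times the probability of the window event, which is positive. *)
Lemma stationary_window_flow n b : stationary r mu -> (0 < n)%N -> window_flow n b = 0.
Proof.
move=> st n0; have [_ h] := st _ (bounded_cylinder_indic (window n) b).
have [_] := has_mean_generator n b n0; rewrite h => -[/esym/eqP].
rewrite mulf_eq0 => /orP[|/eqP//]; rewrite gt_eqF//.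
by apply: prodr_gt0 => i _; exact: (site_pmf_gt0 _ _ _ hr hmu).
Qed.

End WindowFlow.

(** * Necessity *)

Definition set_coord (b : config) (k z : int) : config :=
  fun i => if i == k then z else b i.

Lemma set_coord_eq b k z : set_coord b k z k = z.
Proof. by rewrite /set_coord eqxx. Qed.

Lemma set_coord_neq b k z i : i != k -> set_coord b k z i = b i.
Proof. by rewrite /set_coord => /negbTE->. Qed.

(** * Sign and decay arguments over the reals *)

Section RealLemmas.
Context {R : realType}.

(* Writing [t i] for [E i - 1], the first two equations force [t 0], [t 1] and
   [t 2] to have the same sign, and then both terms of the third one are
   nonnegative. *)
Lemma sign_mixed_difference (E0 E1 E2 A B D D' : R) :
  0 < E1 -> 0 < E2 -> 0 < A -> 0 < B -> 0 <= D -> 0 <= D' ->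
  (E0 - 1) * D - (E1 - 1) * D' + A * (E0 - 1) + B * (E1^-1 - 1) = 0 ->
  (E1 - 1) * D - (E2 - 1) * D' + A * (E1 - 1) + B * (E2^-1 - 1) = 0 ->
  A * (E0 - 1) * (E1 - 1) + B * (E1^-1 - 1) * (E2^-1 - 1) = 0 ->
  [/\ E0 = 1, E1 = 1 & E2 = 1].
Proof.
move=> E1p E2p Ap Bp D0 D'0 eq1 eq2 eq3.
have I1 : 0 < E1^-1 by rewrite invr_gt0.
have I2 : 0 < E2^-1 by rewrite invr_gt0.
have v1 : E1 * E1^-1 = 1 by rewrite divff// gt_eqF.
have v2 : E2 * E2^-1 = 1 by rewrite divff// gt_eqF.
have e1 : (E0 - 1) * (A + D) = (E1 - 1) * (D' + B * E1^-1).
  apply/eqP; rewrite -subr_eq0 -eq1; apply/eqP.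
  have -> : B * (E1^-1 - 1) = B * (E1^-1 - E1 * E1^-1) by rewrite v1.
  ring.
have e2 : (E1 - 1) * (A + D) = (E2 - 1) * (D' + B * E2^-1).
  apply/eqP; rewrite -subr_eq0 -eq2; apply/eqP.
  have -> : B * (E2^-1 - 1) = B * (E2^-1 - E2 * E2^-1) by rewrite v2.
  ring.
set P := A + D in e1 e2; set Q := D' + B * E1^-1 in e1; set Q' := D' + _ in e2.
have Pp : 0 < P by rewrite ltr_wpDr.
have Qp : 0 < Q by rewrite ltr_wpDl// mulr_gt0.
have Q'p : 0 < Q' by rewrite ltr_wpDl// mulr_gt0.
have t0 : E0 - 1 = (E1 - 1) * (Q / P).
  by rewrite mulrA -e1 mulfK// gt_eqF.
have t2 : E2 - 1 = (E1 - 1) * (P / Q').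
  by rewrite mulrA e2 mulfK// gt_eqF.
have : (E1 - 1) ^+ 2 * (A * (Q / P) + B * E1^-1 * E2^-1 * (P / Q')) = 0.
  rewrite -eq3 t0.
  have -> : E1^-1 - 1 = - (E1 - 1) * E1^-1 by rewrite mulNr mulrBl v1; ring.
  have -> : E2^-1 - 1 = - (E2 - 1) * E2^-1 by rewrite mulNr mulrBl v2; ring.
  rewrite t2; ring.
move=> /eqP; rewrite mulf_eq0 expf_eq0/= => /orP[/eqP u0|].
  by split; apply/eqP; rewrite -subr_eq0 ?t0 ?t2 u0 ?mul0r.
have pos1 : 0 < A * (Q / P) by rewrite mulr_gt0 ?divr_gt0.
have pos2 : 0 < B * E1^-1 * E2^-1 * (P / Q') by rewrite !mulr_gt0 ?divr_gt0 ?invr_gt0.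
by rewrite gt_eqF// addr_gt0.
Qed.

Lemma le_expR_eq0 (d x : R) : 0 < d -> 0 <= x ->
  (forall m : nat, x <= expR (- (d * m%:R))) -> x = 0.
Proof.
move=> d0 x0 xm; apply/eqP; rewrite eq_le x0 andbT leNgt; apply/negP => xp.
(* This [m] suffices because [expR (d * m) >= 1 + d * m], which exceeds [x^-1]. *)
have [m hm] : exists m : nat, x^-1 / d < m%:R.
  exists (Num.bound (x^-1 / d)); apply: archi_boundP.
  by rewrite divr_ge0 ?invr_ge0// ltW.
have := xm m; apply/negP; rewrite -ltNge expRN.
rewrite -[ltRHS]invrK ltf_pV2 ?posrE ?expR_gt0 ?invr_gt0//.
apply: lt_le_trans (expR_ge1Dx _).
by rewrite ltr_wpDl// mulrC -ltr_pdivrMr.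
Qed.

End RealLemmas.

(** * Functional equations for the rate function *)

Section RateFunction.
Context {R : realType} (r : int -> R) (hr : rate_function r).

Lemma const_of_succ : (forall z, r (z + 1) = r z) -> False.
Proof.
case: (hr) => _ _ nc _ h; apply: nc; exists (r 0).
elim/int_rect => // n <-.
  by rewrite -[RHS]h; congr r; lia.
by rewrite -[LHS]h; congr r; lia.
Qed.

(** At such a [z] the coefficients [1 - r z * r (- z)] and [r (z + 1) - r z] of the two tracer jumps
    are strictly positive. *)
Lemma rate_strict : exists z, r z < r (z + 1).
Proof.
apply/not_existsP => h; apply: const_of_succ => z.
apply/eqP; rewrite eq_le (rate_le _ hr z (z + 1)) ?andbT ?lerDl//.
by rewrite leNgt; apply/negP => /h.
Qed.

Lemma rate_mulN_le1 z : r z * r (- z) <= 1.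
Proof.
by rewrite rateN// ler_pdivrMr ?rate_gt0// mul1r (rate_le _ hr)// lerDl.
Qed.

Lemma rate_mulN_lt1 z : r z < r (z + 1) -> r z * r (- z) < 1.
Proof. by move=> h; rewrite rateN// ltr_pdivrMr ?rate_gt0// mul1r. Qed.

(** If [d] is nonzero, the equation makes [h y = (1 - r y * r (- y)) * expR (d * y)] monotone,
    non-decreasing in the direction in which its bound [expR (d * y)] decays. So [h] vanishes, that
    is [r (z + 1) = r z] for all [z], against non-constancy. *)
Lemma tilt_eq0 (d a c : R) : 0 < a ->
  (forall z, (expR d - 1) * r z + a * ((1 - r z * r (- z)) * expR (d * z%:~R)) = c) ->
  d = 0.
Proof.
move=> a0 hc; apply/eqP; apply/negPn/negP => dn0; apply: const_of_succ => z.
pose h y := (1 - r y * r (- y)) * expR (d * y%:~R).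
have h_ge0 y : 0 <= h y by rewrite mulr_ge0 ?expR_ge0// subr_ge0 rate_mulN_le1.
have h_le y : h y <= expR (d * y%:~R).
  rewrite -[leRHS]mul1r ler_wpM2r ?expR_ge0// gerBl mulr_ge0//; exact: rate_ge0.
have hE y y' : a * (h y' - h y) = (expR d - 1) * (r y - r y').
  by have := hc y; rewrite -(hc y') -!/(h _) => e; lra.
(* The walk goes to the left for positive [d] and to the right for negative [d]. *)
have tail (m : nat) : exists2 y, h z <= h y &
      expR (d * y%:~R) = expR (d * z%:~R) * expR (- (`|d| * m%:R)).
  have [dp|dm] := ltP 0 d.
    exists (z - m%:Z).
      rewrite -subr_ge0 -(pmulr_rge0 _ a0) hE mulr_ge0//.
        by rewrite subr_ge0 -expR0 ler_expR ltW.
      by rewrite subr_ge0 (rate_le _ hr)// gerBl.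
    by rewrite -expRD (gtr0_norm dp) intrD mulrDr mulrNz mulrN.
  exists (z + m%:Z).
    rewrite -subr_ge0 -(pmulr_rge0 _ a0) hE mulr_le0//.
      by rewrite subr_le0 -expR0 ler_expR.
    by rewrite subr_le0 (rate_le _ hr)// lerDl.
  by rewrite -expRD (ler0_norm dm) intrD mulrDr mulNr opprK.
have hz0 : h z / expR (d * z%:~R) = 0.
  apply: (le_expR_eq0 `|d|); first by rewrite normr_gt0.
    by rewrite divr_ge0 ?expR_ge0.
  move=> m; have [y hy ey] := tail m.
  by rewrite ler_pdivrMr ?expR_gt0// mulrC -ey (le_trans hy).
have e0 : expR (d * z%:~R) != 0 by rewrite gt_eqF ?expR_gt0.
move: hz0; rewrite /h mulfK// rateN// => /eqP.
by rewrite subr_eq0 => /eqP/esym/divr1_eq.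
Qed.

(** Together with the reflection identity the hypothesis reads [r z = q * r (z + 1)], a geometric
    recursion. *)
Lemma rate_exponential (q : R) : (forall z, r z * r (- z) = q) ->
  exists2 beta, 0 < beta &
    forall z, r z = expR (- beta / 2) * expR (beta * z%:~R).
Proof.
(* The value of [beta] is forced by [r 0 = expR (- beta / 2)]; then
   [q = r 0 * r 0 = expR (- beta)]. *)
move=> hq; pose beta := - (2 * ln (r 0)).
have r0E : r 0 = expR (- beta / 2).
  rewrite (_ : - beta / 2 = ln (r 0)); last by rewrite /beta; field.
  by rewrite lnK// posrE rate_gt0.
have qE : q = expR (- beta).
  by rewrite -(hq 0) oppr0 r0E -expRD; congr expR; field.
have rS z : r z = r (z + 1) * expR (- beta).
  by rewrite -qE -(hq z) rateN// mulrCA divff ?mulr1// gt_eqF// rate_gt0.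
have rE z : r z = expR (- beta / 2) * expR (beta * z%:~R).
  elim/int_rect: z => [|n IHn|n IHn]; first by rewrite mulr0 expR0 mulr1.
    apply: (mulIf (lt0r_neq0 (expR_gt0 (- beta)))).
    have -> : n.+1%:Z = n%:Z + 1 by lia.
    rewrite -rS IHn -!expRD intrD; congr expR; ring.
  have := rS (- n.+1%:Z); have -> : - n.+1%:Z + 1 = - n%:Z by lia.
  rewrite IHn => ->; have -> : - n.+1%:Z = - n%:Z - 1 by lia.
  by rewrite -!expRD intrD; congr expR; ring.
exists beta => //; rewrite lt_neqAle; apply/andP; split; last first.
  have := rate_le _ hr 0 1 ler01.
  by rewrite !rE -!expRD ler_expR; lra.
apply/eqP => b0; apply: const_of_succ => z.
by rewrite !rE -b0 !mul0r.
Qed.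

End RateFunction.

(** * Determination of [theta] and [r] from vanishing flow *)

Section Necessity.
Context {R : realType} (r theta : int -> R) (mu : probability Omega R).
Context (hr : rate_function r) (hmu : is_product_measure r theta mu).

Local Notation p := (fun i z => site_pmf r (theta i) z).

(** The factorials cancel in the ratio, leaving a pure exponential in [z]; comparing with [z'] also
    removes the normalising constants. *)
Lemma site_pmf_ratio i j z z' :
  p i z / p j z = expR ((theta i - theta j) * (z - z')%:~R) * (p i z' / p j z').
Proof.
have pz := site_pmf_gt0 _ _ _ hr hmu j z; have pz' := site_pmf_gt0 _ _ _ hr hmu j z'.
apply: (mulIf (lt0r_neq0 pz)); rewrite divfK ?gt_eqF//.
apply: (mulIf (lt0r_neq0 pz')).
transitivity (expR ((theta i - theta j) * (z - z')%:~R) * p i z' * p j z); last first.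
  by field; rewrite gt_eqF.
rewrite /site_pmf /site_weight.
have e : expR (theta i * z%:~R) * expR (theta j * z'%:~R) =
   expR ((theta i - theta j) * (z - z')%:~R) * expR (theta i * z'%:~R)
     * expR (theta j * z%:~R).
  by rewrite -!expRD; congr expR; rewrite intrB; ring.
set a := fine _; set b := fine _.
transitivity (a^-1 / rfact r `|z|%N * (b^-1 / rfact r `|z'|%N) *
  (expR (theta i * z%:~R) * expR (theta j * z'%:~R))); first ring.
rewrite e; ring.
Qed.

Lemma shift_density_gt0 m s b : 0 < shift_density r theta m s b.
Proof.
by apply: prodr_gt0 => i _; rewrite divr_gt0 ?(site_pmf_gt0 _ _ _ hr hmu).
Qed.

Lemma shift_density_set_coord m s b k z : uniq s -> k \in s ->
  shift_density r theta m s (set_coord b k z) =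
  expR ((theta (k - m) - theta k) * (z - b k)%:~R) * shift_density r theta m s b.
Proof.
move=> us sk.
have -> : expR ((theta (k - m) - theta k) * (z - b k)%:~R) =
    \prod_(j <- s) (if j == k then expR ((theta (k - m) - theta k) * (z - b k)%:~R) else 1).
  by rewrite prodr_single// sk.
rewrite /shift_density -big_split; apply: eq_bigr => j _ /=.
rewrite /set_coord; case: eqVneq => [->|_]; last by rewrite mul1r.
exact: site_pmf_ratio.
Qed.

Lemma sum_site_flow_set_coord s b k z : uniq s -> k \in s ->
  \sum_(j <- s) site_flow r theta j (set_coord b k z j) =
  \sum_(j <- s) site_flow r theta j (b j) - site_flow r theta k (b k)
    + site_flow r theta k z.
Proof.
move=> us sk; rewrite !(bigD1_seq k)//= set_coord_eq.
under eq_bigr => j jk do rewrite set_coord_neq//.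
ring.
Qed.

Context (st : stationary r mu).

Let flow0 n b : (0 < n)%N -> window_flow r theta n b = 0.
Proof. exact: (stationary_window_flow _ _ _ hr hmu n b st). Qed.

(** The values at [k] and [k + 1] vary over 0 and 1. The excluded [k] are those for which one of
    these sites is [-1], [0] or [1], where the tracer terms read the configuration. *)
Lemma theta_far k : k \notin [:: -2; -1; 0; 1] ->
  [/\ theta (k - 1) = theta k, theta k = theta (k + 1) & theta (k + 1) = theta (k + 2)].
Proof.
rewrite !inE !negb_or => /and4P[k2 k1 k0 kp1].
have [x0 hx0] := rate_strict _ hr.
pose n := `|k|.+2%N.
(* The value [x0] at [1] makes the left jump contribute with [A > 0], and at [-1] it makes the right
   jump contribute with [B > 0]. *)
pose base : config := fun i => if (i == -1) || (i == 1) then x0 else 0.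
pose b x y := set_coord (set_coord base k x) (k + 1) y.
have kn : k \in window n by rewrite mem_window; lia.
have kn1 : k + 1 \in window n by rewrite mem_window; lia.
have un := window_uniq n.
have kk1 : k + 1 != k by lia.
have k_p1 : k - -1 = k + 1 by lia.
have k1_p1 : k + 1 - -1 = k + 2 by lia.
have bk : base k = 0 by rewrite /base (negbTE k1) (negbTE kp1).
have bk1 : base (k + 1) = 0 by rewrite /base ifF//; lia.
have bE x y i : i \in [:: -1; 0; 1] -> b x y i = base i.
  by rewrite !inE => ii; rewrite /b /set_coord; do 2?[case: eqP; first lia].
pose A := expR (theta (-1) - theta 0) * (1 - r x0 * r (- x0)) * r 0
   * shift_density r theta 1 (window n) base.
pose B := (r (x0 + 1) - r x0) * shift_density r theta (-1) (window n) base.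
have Ap : 0 < A.
  rewrite !mulr_gt0 ?expR_gt0 ?(rate_gt0 _ hr) ?shift_density_gt0//.
  by rewrite subr_gt0 rate_mulN_lt1.
have Bp : 0 < B by rewrite mulr_gt0 ?shift_density_gt0// subr_gt0.
pose c := window_flow r theta n (b 0 0) - site_flow r theta k 0
  - site_flow r theta (k + 1) 0 - A - B.
pose E j := expR (theta (j - 1) - theta j).
(* Boolean exponents turn the tilts into powers 0 or 1; [c] collects all that does not depend on [x]
   and [y]. *)
have H (x y : bool) : c + site_flow r theta k x%:Z + site_flow r theta (k + 1) y%:Z
    + A * (E k ^+ x * E (k + 1) ^+ y)
    + B * ((E (k + 1))^-1 ^+ x * (E (k + 2))^-1 ^+ y) = 0.
  have flowE (x' y' : int) : window_flow r theta n (b x' y') =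
     boundary_flow theta n + \sum_(j <- window n) site_flow r theta j (base j)
     - site_flow r theta k 0 + site_flow r theta k x'
     - site_flow r theta (k + 1) 0 + site_flow r theta (k + 1) y'
     + expR (theta (-1) - theta 0) * r (- x0) * (r 0 * r 0 - 1)
     + A * (expR ((theta (k - 1) - theta k) * x'%:~R) *
           expR ((theta k - theta (k + 1)) * y'%:~R))
     + B * (expR ((theta (k + 1) - theta k) * x'%:~R) *
           expR ((theta (k + 2) - theta (k + 1)) * y'%:~R))
     - r 1 + r 0.
    rewrite /window_flow !bE// /b !sum_site_flow_set_coord//.
    rewrite !shift_density_set_coord// !set_coord_neq// bk bk1 !subr0.
    rewrite addrK k_p1 k1_p1.
    rewrite (_ : base (-1) = x0)// (_ : base 0 = 0)// (_ : base 1 = x0)//.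
    rewrite oppr0 add0r /A /B; ring.
  have h := flow0 n (b x%:Z y%:Z) isT; rewrite flowE in h.
  rewrite -[RHS]h /c flowE !mulr0z !mulr0 !expR0.
  have -> : k + 2 = k + 1 + 1 by lia.
  rewrite /E addrK.
  have eV (t t' : R) (z : bool) : (expR (t - t'))^-1 ^+ z = expR ((t' - t) * z%:~R).
    by rewrite -expRN opprB; case: z; rewrite ?mulr1 ?mulr0 ?expR0.
  have eD (t t' : R) (z : bool) : (expR (t - t')) ^+ z = expR ((t - t') * z%:~R).
    by case: z; rewrite ?mulr1 ?mulr0 ?expR0.
  by rewrite !eV !eD addrK; ring.
have sE z : site_flow r theta k z = (E k - 1) * r z + (E (k + 1) - 1) * r (- z).
  by rewrite /site_flow /E addrK.
have sE1 z : site_flow r theta (k + 1) z = (E (k + 1) - 1) * r z + (E (k + 2) - 1) * r (- z).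
  by rewrite /site_flow /E (_ : k + 2 - 1 = k + 1) -?addrA.
have := H false false; have := H false true; have := H true false; have := H true true.
rewrite !sE !sE1 oppr0 !expr0 !expr1 !mulr1 !mul1r => h11 h10 h01 h00.
(* Two first differences and the mixed second difference of the four equations. The site flows are
   additive in the two values, so the last one sees only the densities. *)
have diff (u v : R) : u = 0 -> v = 0 -> u - v = 0 by move=> -> ->; rewrite subrr.
have [] := sign_mixed_difference (E k) (E (k + 1)) (E (k + 2)) A B
  (r 1 - r 0) (r 0 - r (-1)) (expR_gt0 _) (expR_gt0 _) Ap Bp.
- by rewrite subr_ge0 (rate_le _ hr).
- by rewrite subr_ge0 (rate_le _ hr).
- by rewrite -[RHS](diff _ _ h10 h00); ring.
- by rewrite -[RHS](diff _ _ h01 h00); ring.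
- by rewrite -[RHS](diff _ _ (diff _ _ h11 h10) (diff _ _ h01 h00)); ring.
have E1 j : E j = 1 -> theta (j - 1) = theta j.
  by rewrite /E -[RHS]expR0 => /expR_inj/eqP; rewrite subr_eq0 => /eqP.
move=> /E1 e1 /E1 e2 /E1 e3; split => //; first by rewrite -e2 addrK.
by rewrite -e3; congr theta; lia.
Qed.

Lemma theta_left i : i <= -1 -> theta i = theta (-1).
Proof.
have step j : j <= -2 -> theta j = theta (j + 1).
  (* The case [j = -2] is excluded from [theta_far] itself and comes from the last equality at
     [-3]. *)
  rewrite le_eqVlt => /predU1P[->|j2]; first by have [] := theta_far (-3) isT.
  by have [|//] := theta_far j; rewrite !inE; lia.
suff h (n : nat) : theta (- n%:Z - 1) = theta (-1).
  by move=> i1; rewrite -(h (absz (i + 1))); congr theta; lia.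
elim: n => // n <-; rewrite step; last lia.
by congr theta; lia.
Qed.

Lemma theta_right i : 1 <= i -> theta i = theta 1.
Proof.
have step j : 1 <= j -> theta j = theta (j + 1).
  rewrite le_eqVlt => /predU1P[<-|j2]; first by have [] := theta_far 2 isT.
  by have [|//] := theta_far j; rewrite !inE; lia.
suff h (n : nat) : theta (n%:Z + 1) = theta 1.
  by move=> i1; rewrite -(h (absz (i - 1))); congr theta; lia.
elim: n => // n <-; rewrite [RHS]step; last lia.
by congr theta; lia.
Qed.

(** Only [b 1] varies. Since [theta 1 = theta 2], the site term keeps only its [r z] half and the
    density of the right jump is constant; the left jump supplies the tilted term. *)
Lemma flow_at_one : exists a c : R, 0 < a /\ forall z,
  (expR (theta 0 - theta 1) - 1) * r z
  + a * ((1 - r z * r (- z)) * expR ((theta 0 - theta 1) * z%:~R)) = c.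
Proof.
pose base : config := fun=> 0.
exists (expR (theta (-1) - theta 0) * r 0 * shift_density r theta 1 (window 1) base).
exists (- (boundary_flow theta 1 + \sum_(j <- window 1) site_flow r theta j (base j)
   - site_flow r theta 1 0
   + expR (theta (-1) - theta 0) * r 0 * (r 0 * r 0 - 1)
   + (r 1 - r 0) * shift_density r theta (-1) (window 1) base - r 1 + r 0)).
split=> [|z].
  by rewrite !mulr_gt0 ?expR_gt0 ?(rate_gt0 _ hr) ?shift_density_gt0.
have := flow0 1 (set_coord base 1 z) isT.
rewrite /window_flow sum_site_flow_set_coord ?window_uniq ?mem_window//.
rewrite !shift_density_set_coord ?window_uniq ?mem_window//.
rewrite set_coord_eq !set_coord_neq// /base.
have -> : site_flow r theta 1 z = (expR (theta 0 - theta 1) - 1) * r z.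
  by rewrite /site_flow (theta_right (1 + 1))// [1 - 1]subrr subrr expR0 subrr mul0r addr0.
have -> : 1 - -1 = 2 :> int by [].
rewrite (theta_right 2)// !subrr mul0r expR0 !add0r !oppr0 subr0 => e.
apply/eqP; rewrite -subr_eq0 opprK -[X in _ == X]e; apply/eqP; ring.
Qed.

Lemma theta_zero_one : theta 0 = theta 1.
Proof.
have [a [c [a0 h]]] := flow_at_one.
by apply/eqP; rewrite -subr_eq0; apply/eqP; exact: (tilt_eq0 _ hr _ a c).
Qed.

Lemma rate_is_exponential : exists2 beta, 0 < beta &
  forall z, r z = expR (- beta / 2) * expR (beta * z%:~R).
Proof.
have [a [c [a0 h]]] := flow_at_one.
apply: (rate_exponential _ hr (1 - c / a)) => z.
have := h z; rewrite theta_zero_one subrr expR0 subrr !mul0r add0r expR0 mulr1 => <-.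
by rewrite mulrAC divff ?gt_eqF// mul1r opprB addrC subrK.
Qed.

(** Comparing the flows for [b (-1) = 0] and [b (-1) = 1] gives an equation that factors, with [expR
    (theta (-1) - theta 0) * expR (- beta) - 1] as the only factor that can vanish. *)
Lemma theta_jump (beta : R) : 0 < beta ->
  (forall z, r z = expR (- beta / 2) * expR (beta * z%:~R)) ->
  theta 0 = theta (-1) - beta.
Proof.
move=> beta0 rE; pose base : config := fun=> 0.
pose B := shift_density r theta (-1) (window 1) base.
have Bp : 0 < B by exact: shift_density_gt0.
have q0 := expR_gt0 (- beta); set q := expR (- beta) in q0.
have qV : q^-1 = expR beta by rewrite /q -expRN opprK.
have r0 := rate_gt0 _ hr 0; have q1 : q < 1 by rewrite /q -expR0 ltr_expR; lra.
have rS z : r (z + 1) = r z / q.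
  by rewrite !rE qV -!expRD intrD; congr expR; ring.
have r1E : r 1 = r 0 / q by rewrite -rS.
have r2E : r 2 = r 0 / q / q by rewrite -!rS.
have rm1 : r (-1) = r 0 * q by rewrite -[r 0]/(r (-1 + 1)) rS divfK// gt_eqF.
have r00 : r 0 * r 0 = q by rewrite !rE -!expRD; congr expR; field.
pose e := expR (theta (-1) - theta 0).
have e0 : 0 < e := expR_gt0 _.
have flowE (x : bool) : window_flow r theta 1 (set_coord base (-1) x%:Z) =
    boundary_flow theta 1 + \sum_(j <- window 1) site_flow r theta j (base j)
    - site_flow r theta (-1) 0 + (e - 1) * r (- x%:Z)
    + e * r (- x%:Z) * (r 0 * r 0 - 1)
    + e * (1 - r 0 * r 0) * r 0 * shift_density r theta 1 (window 1) base
    + (r (x%:Z + 1) - r x%:Z) * (e^-1 ^+ x * B) - r 1 + r 0.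
  rewrite /window_flow sum_site_flow_set_coord ?window_uniq ?mem_window//.
  rewrite !shift_density_set_coord ?window_uniq ?mem_window//.
  rewrite set_coord_eq !set_coord_neq// /base.
  have -> : site_flow r theta (-1) x%:Z = (e - 1) * r (- x%:Z).
    by rewrite /site_flow (theta_left (-1 - 1))// subrr expR0 subrr mul0r add0r.
  have -> : -1 - -1 = 0 :> int by [].
  rewrite (theta_left (-1 - 1))// !subrr !mul0r expR0 !add0r !oppr0 subr0 -/e.
  have -> : expR ((theta 0 - theta (-1)) * x%:Z%:~R) = e^-1 ^+ x.
    by rewrite /e -expRN opprB; case: (x); rewrite ?mulr1 ?mulr0 ?expR0.
  rewrite /B /base; ring.
have := flow0 1 (set_coord base (-1) 0%:Z) isT; rewrite (flowE false).
have := flow0 1 (set_coord base (-1) 1%:Z) isT; rewrite (flowE true).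
rewrite (_ : 1%:Z + 1 = 2)// (_ : 0%:Z + 1 = 1)// !expr0 !expr1 r00 oppr0.
rewrite r2E r1E rm1 => h1 h0.
have : (e * q - 1) * (r 0 * (1 - q) * (1 + B / q / q / e)) = 0.
  have diff (u v : R) : u = 0 -> v = 0 -> u - v = 0 by move=> -> ->; rewrite subrr.
  by rewrite -[RHS](diff _ _ h0 h1); field; rewrite !gt_eqF.
move=> /eqP; rewrite mulf_eq0 => /orP[|]; last first.
  rewrite gt_eqF// !mulr_gt0// ?subr_gt0// addr_gt0// !divr_gt0//.
rewrite subr_eq0 /e /q -expRD -[X in _ == X]expR0 => /eqP/expR_inj; lra.
Qed.

End Necessity.

(** * Sufficiency *)

Section Sufficiency.
Context {R : realType} (r theta : int -> R) (mu : probability Omega R).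
Context (hr : rate_function r) (hmu : is_product_measure r theta mu).
Context (beta theta_left : R).
Context (rE : forall z, r z = expR (- beta / 2) * expR (beta * z%:~R)).
Context (thetaE : forall i, theta i = if i <= -1 then theta_left else theta_left - beta).

Local Notation p := (fun i z => site_pmf r (theta i) z).

Lemma rate_succ z : r (z + 1) = expR beta * r z.
Proof. by rewrite !rE mulrCA -!expRD intrD; congr expR; ring. Qed.

Lemma rate_mulN z : r z * r (- z) = expR (- beta).
Proof. by rewrite !rE -!expRD intrN; congr expR; field. Qed.

(** For exponential [r], lowering the parameter by [beta] only translates the law by one. *)
Lemma site_pmf_jump z : p 0 z = p (-1) (z + 1).
Proof.
have p0 i y := site_pmf_gt0 _ _ _ hr hmu i y.
(* Cross-multiplied form of the claim that [p 0 y / p (-1) (y + 1)] does not depend on [y]; the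
   equal total masses then force the constant to be one. *)
have rec y : p 0 (y + 1) * p (-1) (y + 1) = p (-1) (y + 1 + 1) * p 0 y.
  rewrite (site_pmf_succ _ _ hr 0) (site_pmf_succ _ _ hr (-1) (y + 1)).
  rewrite !thetaE/= opprD expRD.
  have -> : r (- y) = expR beta * r (- y - 1) by rewrite -rate_succ subrK.
  have e : expR (- beta) * expR beta = 1 by rewrite -expRD addNr expR0.
  rewrite -[RHS]mulr1 -e; ring.
have prop y : p 0 y * p (-1) (0 + 1) = p (-1) (y + 1) * p 0 0.
  elim/int_rect: y => [|n IHn|n IHn]; first exact: mulrC.
    apply: (mulIf (lt0r_neq0 (p0 (-1) (n%:Z + 1)))).
    have -> : n.+1%:Z = n%:Z + 1 by lia.
    transitivity (p 0 (n%:Z + 1) * p (-1) (n%:Z + 1) * p (-1) (0 + 1)); first ring.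
    rewrite rec -mulrA IHn; ring.
  apply: (mulIf (lt0r_neq0 (p0 (-1) (- n%:Z + 1)))).
  have := rec (- n.+1%:Z); have -> : - n.+1%:Z + 1 = - n%:Z by lia.
  move=> h.
  transitivity (p (-1) (- n%:Z + 1) * p 0 (- n.+1%:Z) * p (-1) (0 + 1)); first ring.
  rewrite -h.
  transitivity (p 0 (- n%:Z) * p (-1) (0 + 1) * p (-1) (- n%:Z)); first ring.
  rewrite IHn; ring.
pose k := p 0 0 / p (-1) (0 + 1).
have pk y : p 0 y = k * p (-1) (y + 1).
  rewrite /k mulrAC; apply: (mulIf (lt0r_neq0 (p0 (-1) (0 + 1)))).
  by rewrite divfK ?gt_eqF// prop mulrC.
have k0 : 0 <= k by rewrite ltW// divr_gt0.
have := site_pmf_total _ _ _ hmu 0.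
under eq_esum do rewrite pk.
rewrite esumZ// => [|y]; last exact/ltW/p0.
rewrite (site_pmf_total_shift _ _ _ hmu) mule1 => -[k1].
by rewrite pk k1 mul1r.
Qed.

Lemma window_flow_eq0 n b : (0 < n)%N -> window_flow r theta n b = 0.
Proof.
move=> n0; have un := window_uniq n.
have w0 : 0 \in window n by rewrite mem_window; lia.
have w1 : -1 \in window n by rewrite mem_window; lia.
have p0 i y := site_pmf_gt0 _ _ _ hr hmu i y.
have thl i : i <= -1 -> theta i = theta_left by rewrite thetaE => ->.
have thr i : 0 <= i -> theta i = theta_left - beta.
  by rewrite thetaE => i0; case: ifP => //; lia.
have flowE : \sum_(j <- window n) site_flow r theta j (b j) =
    (expR beta - 1) * (r (- b (-1)) + r (b 0)).
  rewrite (bigD1_seq _ w1)//= [X in _ + X]big_mkcond (bigD1_seq _ w0)//= -big_mkcondr.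
  rewrite big1 ?addr0 => [|j /andP[j0 j1]]; last first.
    rewrite /site_flow.
    have [jn|jp] : j <= -2 \/ 1 <= j by lia.
      by rewrite !thl ?subrr ?expR0 ?subrr ?mul0r ?mul0r ?addr0//; lia.
    by rewrite !thr ?subrr ?expR0 ?subrr ?mul0r ?mul0r ?addr0//; lia.
  have dE : theta_left - (theta_left - beta) = beta by ring.
  rewrite /site_flow !thetaE/= !subrr expR0 dE; ring.
(* The parameters differ after the shift only across the tracer, so one factor survives: at site [0]
   here, at site [-1] for the opposite shift. *)
have densL : shift_density r theta 1 (window n) b = expR (- theta_left) * r (b 0 + 1).
  rewrite /shift_density (bigD1_seq _ w0)//= big1 ?mulr1 => [|j j0].
    rewrite (_ : 0 - 1 = -1)// site_pmf_jump (site_pmf_succ _ _ hr) (thl (-1))//.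
    have n1 := lt0r_neq0 (p0 (-1) (b 0)); rewrite thl// in n1.
    have n2 := lt0r_neq0 (expR_gt0 theta_left).
    have n3 := lt0r_neq0 (rate_gt0 _ hr (b 0 + 1)).
    by rewrite expRN rateN//; field; rewrite n1 n2 n3.
  have -> : theta (j - 1) = theta j.
    have [jn|jp] : j <= -1 \/ 1 <= j by lia.
      by rewrite !thl//; lia.
    by rewrite !thr//; lia.
  by rewrite divff// gt_eqF.
have densR : shift_density r theta (-1) (window n) b = expR theta_left * r (- b (-1)).
  rewrite /shift_density (bigD1_seq _ w1)//= big1 ?mulr1 => [|j j0].
    rewrite (_ : -1 - -1 = 0)// site_pmf_jump (site_pmf_succ _ _ hr) (thl (-1))//.
    have n1 := lt0r_neq0 (p0 (-1) (b (-1))); rewrite thl// in n1.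
    by rewrite mulfK.
  have -> : theta (j - -1) = theta j.
    have [jn|jp] : j <= -2 \/ 0 <= j by lia.
      by rewrite !thl//; lia.
    by rewrite !thr//; lia.
  by rewrite divff// gt_eqF.
rewrite /window_flow /boundary_flow flowE densL densR !rate_mulN.
have -> : theta (- n%:Z) = theta_left by apply: thl; lia.
have -> : theta (- n%:Z - 1) = theta_left by apply: thl; lia.
have -> : theta n = theta_left - beta by apply: thr; lia.
have -> : theta (n%:Z + 1) = theta_left - beta by apply: thr; lia.
rewrite (thl (-1))// (thr 0)//.
have e1 : expR (- beta) = (expR beta)^-1 by rewrite expRN.
have e2 : expR (- theta_left) = (expR theta_left)^-1 by rewrite expRN.
have -> : theta_left - (theta_left - beta) = beta by ring.
have -> : - (theta_left - beta) = beta - theta_left by ring.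
rewrite !expRD !rate_succ e1 e2.
have rm z : r (- z) = (expR beta * r z)^-1 by rewrite rateN// rate_succ.
have n1 := lt0r_neq0 (expR_gt0 beta); have n2 := lt0r_neq0 (expR_gt0 theta_left).
have n3 := lt0r_neq0 (rate_gt0 _ hr (b 0)).
have n4 := lt0r_neq0 (rate_gt0 _ hr (b (-1))).
by rewrite !rm; field; rewrite n1 n2 n3 n4.
Qed.

End Sufficiency.

(** * Exhaustion of cylinder functions by finite sums of indicators *)

Section CylinderTruncation.
Context {R : realType} (r : int -> R).

Lemma bounded_cylinder_window (phi : config -> R) : bounded_cylinder phi ->
  exists2 n, (0 < n)%N & window_dependent n phi.
Proof.
move=> [[F phiF] _]; exists (\max_(i <- F) absz i).+1%N => // w w' ww.
apply: phiF => i iF; apply: ww; rewrite mem_window.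
by have := leq_bigmax_seq (F := absz) i iF isT; move: (\max_(_ <- _) _)%N => m; lia.
Qed.

Lemma generatorDM n (phi psi : config -> R) c : (0 < n)%N ->
  window_dependent n phi -> window_dependent n psi ->
  generator r (fun w => phi w + c * psi w) =
  fun w => generator r phi w + c * generator r psi w.
Proof.
move=> n0 hphi hpsi; rewrite !(generator_windowE _ _ n)//; last first.
  by move=> w w' ww; rewrite (hphi _ _ ww) (hpsi _ _ ww).
apply/funext => w.
rewrite [X in X + _ + _ + _ = _](_ : _ = \sum_(i <- window_bonds n)
     (r (w i) + r (- w (i + 1))) * (phi (lay_brick i w) - phi w)
   + c * \sum_(i <- window_bonds n)
     (r (w i) + r (- w (i + 1))) * (psi (lay_brick i w) - psi w)); first ring.
by rewrite mulr_sumr -big_split; apply: eq_bigr => i _ /=; ring.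
Qed.

(** Numbers the countably many window configurations, so that a cylinder function can be built up
    one indicator at a time. *)
Definition window_code (n : nat) (w : config) : nat :=
  choice.pickle [seq w i | i <- window n].

Lemma window_codeP n w w' :
  window_code n w = window_code n w' <-> cyl_event (window n) w' w.
Proof.
split=> [/(pcan_inj choice.pickleK)/eq_in_map h i iw|h]; first exact: h.
by congr choice.pickle; apply/eq_in_map => i iw; exact: h.
Qed.

Definition truncate (n N : nat) (phi : config -> R) : config -> R :=
  fun w => if (window_code n w < N)%N then phi w else 0.

Lemma window_dependent_truncate n N (phi : config -> R) :
  window_dependent n phi -> window_dependent n (truncate n N phi).
Proof.
move=> h w w' ww; rewrite /truncate (h _ _ ww).
by have /window_codeP -> : cyl_event (window n) w' w by [].
Qed.

Lemma truncateS n N (phi : config -> R) : window_dependent n phi ->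
  truncate n N.+1 phi = truncate n N phi \/
  exists b, truncate n N.+1 phi =
    fun w => truncate n N phi w + phi b * \1_(cyl_event (window n) b) w.
Proof.
move=> hphi; have [[b bN]|none] := pselect (exists b, window_code n b = N).
  right; exists b; apply/funext => w; rewrite /truncate ltnS leq_eqVlt indicE.
  have [wN|wN] /= := eqVneq (window_code n w) N.
    have bw : cyl_event (window n) b w by apply/window_codeP; rewrite wN.
    by rewrite wN ltnn mem_set// mulr1 add0r; exact: hphi.
  rewrite memNset ?mulr0 ?addr0// => /window_codeP wb.
  by rewrite wb bN eqxx in wN.
left; apply/funext => w; rewrite /truncate ltnS leq_eqVlt.
by case: eqVneq => // wN; case: none; exists w.
Qed.

Lemma generator_truncate n (phi : config -> R) w : (0 < n)%N -> window_dependent n phi ->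
  \forall N \near \oo, generator r (truncate n N phi) w = generator r phi w.
Proof.
move=> n0 hphi.
pose code := window_code n.
pose mx := (\max_(i <- window_bonds n) code (lay_brick i w))%N.
(* At a fixed [w] the generator evaluates [phi] at finitely many configurations only, and [m] bounds
   all their codes. *)
pose m := (mx + code w
  + code (lay_brick (-1) w) + code (shift_config 1 (lay_brick (-1) w))
  + code (shift_config (-1) w))%N.
exists m.+1 => // N /= mN.
have T w' : (code w' <= m)%N -> truncate n N phi w' = phi w'.
  by move=> cm; rewrite /truncate ifT// (leq_ltn_trans cm).
rewrite !(generator_windowE _ _ n)//; last exact: window_dependent_truncate.
have -> : truncate n N phi w = phi w by apply: T; rewrite /m; lia.
have -> : truncate n N phi (lay_brick (-1) w) = phi (lay_brick (-1) w).
  by apply: T; rewrite /m; lia.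
have -> : truncate n N phi (shift_config 1 (lay_brick (-1) w)) =
    phi (shift_config 1 (lay_brick (-1) w)) by apply: T; rewrite /m; lia.
have -> : truncate n N phi (shift_config (-1) w) = phi (shift_config (-1) w).
  by apply: T; rewrite /m; lia.
do 3!congr (_ + _); apply: eq_big_seq => i ib; rewrite T//.
have : (code (lay_brick i w) <= mx)%N.
  exact: (leq_bigmax_seq (F := fun i => code (lay_brick i w)) i ib).
by rewrite /m; lia.
Qed.

End CylinderTruncation.

(** * Passage to bounded cylinder functions by dominated convergence *)

Section DominatedExtension.
Context {R : realType} (r theta : int -> R) (mu : probability Omega R).
Context (hr : rate_function r) (hmu : is_product_measure r theta mu).

Lemma has_mean_coord_rate j : has_mean mu (fun w => r (w j)) (expR (theta j)).
Proof.
have := has_mean_rate _ _ _ hr hmu [::] (fun=> 0) j isT.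
rewrite cyl_event_nil /cyl_prob big_nil mulr1 /cond_rate in_nil indicT.
by under eq_fun do rewrite mulr1.
Qed.

Lemma has_mean_coord_rateN j : has_mean mu (fun w => r (- w j)) (expR (- theta j)).
Proof.
have := has_mean_rateN _ _ _ hr hmu [::] (fun=> 0) j isT.
rewrite cyl_event_nil /cyl_prob big_nil mulr1 /cond_rateN in_nil indicT.
by under eq_fun do rewrite mulr1.
Qed.

(** The bound [K] controls [r (w 0 + 1)], the rate of the right jump, by the integrable
    [r (w 0)]. *)
Lemma stationary_of_window_flow (K : R) :
  (forall z, r (z + 1) <= K * r z) ->
  (forall n b, (0 < n)%N -> window_flow r theta n b = 0) ->
  stationary r mu.
Proof.
move=> rK flow0 phi hb; have [n n0 hphi] := bounded_cylinder_window _ hb.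
have [_ [M phiM]] := hb.
have M0 : 0 <= M by apply: le_trans (phiM (fun=> 0)).
pose f N := generator r (truncate n N phi).
have f0 N : has_mean mu (f N) 0.
  elim: N => [|N IHN].
    have -> : f 0%N = fun=> 0; last exact: has_mean0.
    have t0 : truncate n 0 phi = fun=> 0 by apply/funext.
    rewrite /f t0 (generator_windowE _ _ n)//; apply/funext => w.
    by rewrite subrr !mulr0 !addr0 big1// => i _; rewrite mulr0.
  (* Each step adds a multiple of one window indicator, whose generator has mean zero by [flow0]. *)
  have [e|[b e]] := truncateS n N phi hphi; first by rewrite /f e.
  rewrite /f e (generatorDM _ n)//; last 2 first.
  - exact: window_dependent_truncate.
  - exact: window_dependent_indic.
  rewrite -[X in has_mean _ _ X](addr0 0); apply: has_meanD => //.
  rewrite -[X in has_mean _ _ X](mulr0 (phi b)); apply: has_meanZ.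
  have := has_mean_generator _ _ _ hr hmu n b n0.
  by rewrite flow0// mulr0.
(* Increments of [phi] are at most [2 * M]. The two copies of [r (- w 0)] dominate the correction
   term and the left jump, and [K * r (w 0)] the right jump. *)
pose g w := 2 * M * (\sum_(i <- window_bonds n) (r (w i) + r (- w (i + 1)))
  + r (- w 0) + r (- w 0) + K * r (w 0)).
have [gi _] : has_mean mu g (2 * M * (\sum_(i <- window_bonds n)
    (expR (theta i) + expR (- theta (i + 1)))
    + expR (- theta 0) + expR (- theta 0) + K * expR (theta 0))).
  apply: has_meanZ; apply: has_meanD; last exact/has_meanZ/has_mean_coord_rate.
  apply: has_meanD; last exact: has_mean_coord_rateN.
  apply: has_meanD; last exact: has_mean_coord_rateN.
  apply: (has_mean_sum mu _ _ (fun i w => r (w i) + r (- w (i + 1)))) => i.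
  by apply: has_meanD; [exact: has_mean_coord_rate|exact: has_mean_coord_rateN].
have r0 z := rate_ge0 _ hr z.
have fg N w : `|f N w| <= g w.
  rewrite /f (generator_windowE _ _ n)//; last exact: window_dependent_truncate.
  have TM w' : `|truncate n N phi w'| <= M.
    by rewrite /truncate; case: ifP => _; rewrite ?normr0.
  have T2 w' w'' a A : 0 <= a -> a <= A ->
      `|a * (truncate n N phi w' - truncate n N phi w'')| <= 2 * M * A.
    move=> a0 aA; rewrite normrM ger0_norm// mulrC ler_pM//.
    by rewrite (le_trans (ler_normB _ _))// mulr_natl mulr2n lerD.
  have T2N w' w'' a A : 0 <= - a -> - a <= A ->
      `|a * (truncate n N phi w' - truncate n N phi w'')| <= 2 * M * A.
    by move=> a0 aA; rewrite -normrN -mulNr; exact: T2.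
  rewrite /g 3![in leRHS]mulrDr mulr_sumr.
  have rm1 : r (- w 0 - 1) <= r (- w 0) by apply: (rate_le _ hr); rewrite gerBl.
  have rp1 : r (w 0) <= r (w 0 + 1) by apply: (rate_le _ hr); rewrite lerDl.
  apply: (le_trans (ler_normD _ _)); apply: lerD; last first.
    by apply: T2; [rewrite subr_ge0|rewrite (le_trans _ (rK _))// gerBl].
  apply: (le_trans (ler_normD _ _)); apply: lerD; last first.
    by apply: T2; [rewrite subr_ge0|rewrite gerBl].
  apply: (le_trans (ler_normD _ _)); apply: lerD; last first.
    by apply: T2N; rewrite opprB ?subr_ge0// gerBl.
  apply: (le_trans (ler_norm_sum _ _ _)); apply: ler_sum => i _.
  by apply: T2 => //; rewrite addr_ge0.
have fcvg w : (f ^~ w) @ \oo --> generator r phi w.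
  by apply: cvg_near_cst; exact: generator_truncate.
have efcvg (w : Omega) : (fun N => (f N w)%:E) @ \oo --> (generator r phi w)%:E.
  by apply: cvg_EFin; [exact: nearW|exact: fcvg].
have mf N : measurable_fun [set: Omega] ((fun w => (f N w)%:E) : Omega -> \bar R).
  by have [+ _] := f0 N; exact: measurable_int.
have [| | | | |fi _ fint] := @dominated_convergence _ Omega R mu [set: Omega]
  measurableT (fun N w => (f N w)%:E) (fun w => (generator r phi w)%:E)
  (fun w => (g w)%:E).
- exact: mf.
- exact: (emeasurable_fun_cvg _ _ mf (fun w _ => efcvg w)).
- by apply: aeW => w _; exact: efcvg.
- exact: gi.
- by apply: aeW => w N _; rewrite /= lee_fin.
split; first exact: fi.
apply: (cvg_unique (@ereal_hausdorff R) fint).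
by apply: cvg_near_cst; apply: nearW => N; have [_] := f0 N.
Qed.

End DominatedExtension.

Theorem theorem5p1 (R : realType) (r : int -> R) (theta : int -> R)
    (mu : probability Omega R)
    (hr : rate_function r)
    (htheta : forall i : int,
       (- theta_bar r < (theta i)%:E)%E /\ ((theta i)%:E < theta_bar r)%E)
    (hmu : is_product_measure r theta mu) :
  stationary r mu <->
  exists beta theta_left : R,
    [/\ 0 < beta,
        forall z : int, r z = expR (- beta / 2) * expR (beta * z%:~R) &
        forall i : int,
          theta i = if i <= -1 then theta_left else theta_left - beta].
Proof.
split=> [st|[beta [theta_left [beta_gt0 rE thetaE]]]].
  have [beta beta_gt0 rE] := rate_is_exponential _ _ _ hr hmu st.
  exists beta, (theta (-1)); split => // i; case: ifPn => i1.
    exact: (theta_left _ _ _ hr hmu st).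
  rewrite -(theta_jump _ _ _ hr hmu st _ beta_gt0 rE).
  have [->//|i0] := eqVneq i 0.
  rewrite (theta_zero_one _ _ _ hr hmu st).
  by apply: (theta_right _ _ _ hr hmu st); lia.
(* For exponential [r] the growth bound is an equality with [K = expR beta]. *)
apply: (stationary_of_window_flow _ _ _ hr hmu (expR beta)) => [z|n b n0].
  by rewrite (rate_succ _ _ rE).
exact: (window_flow_eq0 _ _ _ hr hmu _ _ rE thetaE).
Qed.
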